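(* There exist constants $C_1>0$ and $C_2>0$, independent of $q_u$ and $q_v$ (and of $h$, $\Delta t$ and $c$), such that the following holds. For every $q_u\in\mathbb{N}$ (so $q_u\ge1$) and $q_v\in\mathbb{N}\cup\{0\}$ there is an explicit time stepping scheme of order $q_T\ge\max(q_u,q_v)$ with a number of stages bounded by $C_2q_T$ such that, for the semi-discrete system $\frac{dW}{dt}=\mathcal{L}_cW$ given by the staggered energy-based discontinuous Galerkin method with central fluxes for the one-dimensional constant-coefficient wave equation with speed $c>0$ on a uniform periodic grid of cell width $h$ (defined in the context), the fully discrete method is stable under the CFL condition $$c\,\Delta t\le C_1h .$$
   Context: Setting: the one-dimensional wave equation $u_t=v$, $v_t=c^2u_{xx}$ with constant speed $c>0$ on $\Omega=[x_{\rm L},x_{\rm R}]$ with periodic boundary conditions. Grids: $x_j=x_{\rm L}+jh$, $j=0,\dots,N$, $h=(x_{\rm R}-x_{\rm L})/N$, $I_j=[x_j,x_{j+1}]$; element centers $\rho_j=(x_j+x_{j+1})/2$; staggered elements $I_{j+\frac12}=[\rho_j,\rho_{j+1}]$. All indices are taken periodically ($x_0$ and $x_N$ are identified), and sums $\sum_j$ run over the $N$ cells. Spaces: $\mathbb{Q}^{k}(I)$ is the space of polynomials of degree at most $k$ on $I$, and $$U_h^{k}=\{w: w|_{I_j}\in\mathbb{Q}^{k}(I_j)\ \forall j\},\qquad \widetilde V_h^{k}=\{w: w|_{I_{j+\frac12}}\in\mathbb{Q}^{k}(I_{j+\frac12})\ \forall j\}.$$ Derivatives are understood piecewise; $\phi^{\pm}(x)=\lim_{\varepsilon\to0\pm}\phi(x+\varepsilon)$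 (periodically). Spatial operator with central fluxes: $\mathcal{L}_c:U_h^{q_u-1}\times\widetilde V_h^{q_v}\to U_h^{q_u-1}\times\widetilde V_h^{q_v}$ is defined by requiring, for all $w,\varphi\in U_h^{q_u-1}$ and $v,\psi\in\widetilde V_h^{q_v}$, $$\int_\Omega\mathcal{L}_c(cw,v)(c\varphi,\psi)\,dx=-c^2\sum_j\left(\int_{x_j}^{x_{j+1}}\varphi_x v\,dx-\varphi^-v\big|_{x_{j+1}}+\varphi^+v\big|_{x_j}\right)-c^2\sum_j\left(\int_{\rho_j}^{\rho_{j+1}}\psi_x w\,dx-\psi^-w\big|_{\rho_{j+1}}+\psi^+w\big|_{\rho_j}\right),$$ the left-hand side being the $L^2(\Omega)^2$ inner product of $\mathcal{L}_c(cw,v)$ with $(c\varphi,\psi)$ ($v$ is single valued at $x_j$ and $w$ is single valued at $\rho_j$). Semi-discrete method: the unknown is $W(t)=(c\,u^h_x(\cdot,t),v^h(\cdot,t))\in U_h^{q_u-1}\times\widetilde V_h^{q_v}$, and $\frac{dW}{dt}=\mathcal{L}_cW$ (no forcing), with $\mathcal{L}_c$ skew-adjoint in $L^2(\Omega)^2$; equivalently, in matrix form, $M_1\frac{dW_1^h}{dt}=A_{11}W_1^h$. (The cell averages of $u^h$ are recovered separately by an integration in time and play no role in stability.) Explicit time stepping schemes: recursions with time step $\Delta t$ of the form $W^{n+1}=R_0(\Delta t\,\mathcal{L}_c)W^n+R_1(\Delta t\,\mathcal{L}_c)W^{n-1}$, with $R_0,R_1$ real polynomials. This class contains one-step methods ($R_1=0$)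 and leap-frog type methods, e.g. those obtained by writing the system as $\frac{d^2W}{dt^2}=\mathcal{L}_c^2W$, namely $W^{n+1}-2W^n+W^{n-1}=P(\Delta t^2\mathcal{L}_c^2)W^n$ with $P$ a real polynomial. The number of stages is the number of applications of the spatial operator $\mathcal{L}_c$ per step (the maximal degree of $R_0,R_1$). The scheme has order $q_T$ if $e^{z}-R_0(z)-R_1(z)e^{-z}=O(z^{q_T+1})$ as $z\to0$. Stability of the fully discrete method is understood in the von Neumann sense: for every eigenvalue $\lambda$ of $\mathcal{L}_c$ (all of which are purely imaginary), all roots $\zeta$ of $\zeta^2=R_0(\Delta t\lambda)\zeta+R_1(\Delta t\lambda)$ satisfy $|\zeta|\le1$. *)

(* Defs.v *)
From HB Require Import structures.
From mathcomp Require Import all_boot all_order all_algebra.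
From mathcomp Require Import all_classical all_reals all_analysis.
From mathcomp Require Import complex.

Set Implicit Arguments.
Unset Strict Implicit.
Unset Printing Implicit Defensive.

Import Order.TTheory GRing.Theory Num.Theory.
Import numFieldNormedType.Exports.

Local Open Scope classical_set_scope.
Local Open Scope ring_scope.

(* Functions that are piecewise polynomial of size at most [n] (degree at most
   [n - 1]) on a periodic mesh of [N] elements: the [j]-th component is the
   polynomial, in the global variable [x], giving the function on the [j]-th
   element. The position of the mesh only enters through [pweval]. *)
Notation pw R N n := {ffun 'I_N -> {poly_n R}}.

(* U_h^(qu - 1) x V~_h^qv; [qu >= 1] and [pw] counts the size, not the degree. *)
Definition state (R : realType) (N qu qv : nat) : vectType R :=
  (pw R N qu * pw R N qv.+1)%type.

(* The periodic function, of period [N * h], equal to [p j] on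
   [y0 + j h, y0 + (j + 1) h[ for [j < N]. *)
Definition pweval (R : realType) (N : nat) (y0 h : R)
    (p : 'I_N -> {poly R}) (x : R) : R :=
  let L := N%:R * h in
  let x' := x - (Num.floor ((x - y0) / L))%:~R * L in
  \sum_(j < N | (y0 + j%:R * h <= x' < y0 + j.+1%:R * h)) (p j).[x'].

Section Method.

Variables (R : realType) (xL xR : R) (N : nat).

Definition cell_width : R := (xR - xL) / N%:R.

Definition node (j : nat) : R := xL + j%:R * cell_width.

Definition center (j : nat) : R := (node j + node j.+1) / 2.

(* U_h lives on the primal elements [x_j, x_(j+1)], V~_h on the staggered ones
   [rho_j, rho_(j+1)], the last of which wraps around by periodicity. *)
Definition ueval n (w : pw R N n) : R -> R :=
  pweval (node 0) cell_width (fun j => val (w j)).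

Definition veval n (v : pw R N n) : R -> R :=
  pweval (center 0) cell_width (fun j => val (v j)).

Definition ueval_x n (w : pw R N n) : R -> R :=
  pweval (node 0) cell_width (fun j => (val (w j))^`()).

Definition veval_x n (v : pw R N n) : R -> R :=
  pweval (center 0) cell_width (fun j => (val (v j))^`()).

Definition intg (a b : R) (f : R -> R) : R :=
  (\int[lebesgue_measure]_(x in `[a, b]) f x)%R.

Definition left_lim (f : R -> R) (a : R) : R := lim (f x @[x --> a^'-]).

Definition right_lim (f : R -> R) (a : R) : R := lim (f x @[x --> a^'+]).

Definition L2_inner qu qv (W Z : state R N qu qv) : R :=
  intg xL xR (fun x => ueval W.1 x * ueval Z.1 x + veval W.2 x * veval Z.2 x).

Definition central_form (c : R) qu qv (w : pw R N qu) (v : pw R N qv.+1)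
    (phi : pw R N qu) (psi : pw R N qv.+1) : R :=
  - c ^+ 2 * (\sum_(j < N)
      (intg (node j) (node j.+1) (fun x => ueval_x phi x * veval v x)
       - left_lim (ueval phi) (node j.+1) * veval v (node j.+1)
       + right_lim (ueval phi) (node j) * veval v (node j)))
  - c ^+ 2 * (\sum_(j < N)
      (intg (center j) (center j.+1) (fun x => veval_x psi x * ueval w x)
       - left_lim (veval psi) (center j.+1) * ueval w (center j.+1)
       + right_lim (veval psi) (center j) * ueval w (center j))).

(* For [xL < xR], [0 < N] and [c != 0], [L2_inner] is an inner product on the
   finite-dimensional space [state], so exactly one [L] satisfies this. *)
Definition is_central_operator (c : R) qu qv (L : 'End(state R N qu qv)) :=
  forall (w phi : pw R N qu) (v psi : pw R N qv.+1),
    L2_inner (L (c *: w, v)) (c *: phi, psi) = central_form c w v phi psi.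

End Method.

(* [L] is real but its eigenvalues need not be: they are those of its matrix in
   some basis of [E], viewed over R[i]. *)
Definition complex_eigenvalue (R : realType) (E : vectType R) (L : 'End(E))
    (lambda : R[i]) : bool :=
  eigenvalue (map_mx (real_complex R) (passmx.mxof (vbasis {:E}) (vbasis {:E}) L)) lambda.

(* W^(n+1) = R0 (dt L) W^n + R1 (dt L) W^(n-1) *)
Record scheme (R : realType) := Scheme { R0 : {poly R}; R1 : {poly R} }.

Definition stages (R : realType) (S : scheme R) : nat :=
  maxn (size (R0 S)).-1 (size (R1 S)).-1.

(* [z] ranges over the reals, which is enough since the left-hand side is an
   entire function with real Taylor coefficients. *)
Definition has_order (R : realType) (S : scheme R) (q : nat) : Prop :=
  (fun z : R => expR z - (R0 S).[z] - (R1 S).[z] * expR (- z) : R^o)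
    =O_ (0 : R) (fun z : R => z ^+ q.+1 : R^o).

Definition von_neumann_stable (R : realType) (E : vectType R)
    (S : scheme R) (dt : R) (L : 'End(E)) : Prop :=
  forall lambda : R[i], complex_eigenvalue L lambda ->
  forall zeta : R[i],
    let z := real_complex R dt * lambda in
    zeta ^+ 2 = (map_poly (real_complex R) (R0 S)).[z] * zeta
              + (map_poly (real_complex R) (R1 S)).[z] ->
    `|zeta| <= 1.

(* Main.v *)
From HB Require Import structures.
Require Import Defs.
From mathcomp Require Import all_boot all_order all_algebra.
From mathcomp Require Import all_classical all_reals all_analysis.
From mathcomp Require Import complex.
From mathcomp Require Import ring lra zify.

Set Implicit Arguments.
Unset Strict Implicit.
Unset Printing Implicit Defensive.

Import Order.TTheory GRing.Theory Num.Theory.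
Import numFieldNormedType.Exports.
Local Open Scope ring_scope.

(** The order of the scheme is only bounded from below, so it may be taken as
large as the degrees [qu] and [qv] require. Two facts are then enough: the
spectrum of the central operator lies on the imaginary axis, within [K c / h]
of the origin, where [K] depends on [qu] and [qv] only ([central_spectrum]);
and there are one-step schemes, with a number of stages at most three times
their order, whose interval of stability on the imaginary axis grows linearly
with the order ([damped_exp_stable]). With [C1 = 1], any such scheme whose
interval contains [[-K, K]] is stable.

Schemes. The interval of stability of the Taylor scheme
[T n = sum_(k < n) z^k / k!] stays bounded as [n] grows; a damping factor
repairs this. In [T n (z) * T n (- z)] the coefficients of degree [1] to [n - 1]
vanish, so that for [z = i y] with [|y| <= Y] one has
[|T n (z)|^2 <= 1 + D |y|^n], where [D] sums the absolute values of the other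
terms at [Y], divided by [Y^n]. If [4] divides [n] then [z^n = y^n], and the
scheme [(1 - D z^n) T n (z)], still of order [n - 1], satisfies
[|(1 - D z^n) T n (z)|^2 <= (1 - d)^2 (1 + d) <= 1] with [d = D y^n], as soon
as [D Y^n <= 1]. For this [Y = n / (2 e)] is admissible, since the sum that
defines [D Y^n] is then at most [e^(-n) * (exp (n / 2))^2 = 1].

Spectrum. The midpoints of the elements of either grid are the nodes of the
other one. On each of the resulting [2 N] half cells both components of the
state are polynomials, and in the local coordinate of [[0, 1]] the inner
product and the central form become sums over the half cells of bilinear forms
that do not depend on the mesh, up to a factor [s = h / 2] in the inner product
([L2_inner_cells], [central_form_cells]). On every half cell the two
contributions to the central form cancel on the diagonal, by integration by
parts ([flux_skew]): the operator is skew. As polynomials of bounded degree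
form a finite dimensional space, these bilinear forms are bounded by the
squared norm of [L^2(0, 1)], with a constant that depends on the degrees only
([bilinear_bounded]). A skew operator with [|<L x, y>| <= B (|x|^2 + |y|^2)]
has its spectrum in [i [-2 B, 2 B]] ([skew_eigenvalue]). *)

(** * Damped truncated exponentials *)

Definition exp_trunc (F : fieldType) (n : nat) : {poly F} :=
  \sum_(k < n) (k`!%:R)^-1 *: 'X^k.

Lemma horner_exp_trunc (F : fieldType) n (z : F) :
  (exp_trunc F n).[z] = \sum_(k < n) z ^+ k / k`!%:R.
Proof.
rewrite horner_sum; apply: eq_bigr => k _.
by rewrite hornerZ hornerXn mulrC.
Qed.

Lemma size_exp_trunc (F : fieldType) n : (size (exp_trunc F n) <= n)%N.
Proof.
apply: leq_trans (size_sum _ _ _) _; apply/bigmax_leqP => k _.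
by apply: leq_trans (size_scale_leq _ _) _; rewrite size_polyXn.
Qed.

Lemma sum_below_antidiag (V : zmodType) (f : nat -> nat -> V) n :
  \sum_(a < n) \sum_(b < n | (a + b < n)%N) f a b =
  \sum_(s < n) \sum_(a < s.+1) f a (s - a)%N.
Proof.
have -> : \sum_(a < n) \sum_(b < n | (a + b < n)%N) f a b =
          \sum_(a < n) \sum_(b < n - a) f a b.
  apply: eq_bigr => a _.
  rewrite (big_ord_widen n (fun b => f a b)) ?leq_subr//.
  by apply: eq_bigl => b; rewrite ltn_subRL.
elim: n => [|n IH]; first by rewrite !big_ord0.
rewrite [RHS]big_ord_recr /= -IH big_ord_recr /= subSnn big_ord1.
rewrite [in RHS]big_ord_recr/= subnn addrA; congr (_ + _).
rewrite -big_split/=; apply: eq_bigr => a _.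
by rewrite subSn ?(ltnW (ltn_ord a))// big_ord_recr.
Qed.

(** The terms below the antidiagonal sum to the truncation of
[exp z * exp (- z) = 1]: by the binomial theorem, those of total degree [s] add
up to [(z - z) ^+ s / s`!]. *)
Lemma exp_trunc_mulN (F : numFieldType) n (z : F) : (0 < n)%N ->
  (exp_trunc F n).[z] * (exp_trunc F n).[- z] = 1 +
  \sum_(a < n) \sum_(b < n | (n <= a + b)%N)
     (z ^+ a / a`!%:R) * ((- z) ^+ b / b`!%:R).
Proof.
move=> n0; rewrite !horner_exp_trunc big_distrl/=.
under eq_bigr do rewrite big_distrr/=.
under eq_bigr => a _ do rewrite (bigID (fun b : 'I_n => (a + b < n)%N))/=.
rewrite big_split/=; congr (_ + _); last first.
  by apply: eq_bigr => a _; apply: eq_bigl => b; rewrite -leqNgt.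
rewrite (sum_below_antidiag
  (fun a b => (z ^+ a / a`!%:R) * ((- z) ^+ b / b`!%:R))).
case: n n0 => // n _; rewrite big_ord_recl/= big_ord1 subn0 !expr0 fact0.
rewrite invr1 !mulr1 big1 ?addr0// => i _.
rewrite /bump/= add1n.
apply: (mulfI (_ : i.+1`!%:R != 0)); first by rewrite pnatr_eq0 -lt0n fact_gt0.
rewrite mulr0; transitivity ((- z + z) ^+ i.+1); last by rewrite addNr expr0n.
rewrite exprDn mulr_sumr.
apply: eq_bigr => a _; have ai : (a <= i.+1)%N by rewrite -ltnS.
rewrite -(bin_fact ai) -mulr_natr !natrM.
have f0 k : (k`!%:R : F) != 0 by rewrite pnatr_eq0 -lt0n fact_gt0.
by field; rewrite !f0.
Qed.

Section DampedExponential.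
Variable R : realType.

(** Half-length of the interval of stability on the imaginary axis. *)
Definition stab_radius (n : nat) : R := n%:R / 2 * expR (- 1).

(** The terms of [exp_trunc_mulN], in absolute value at the radius of stability;
dividing them by the [n]-th power of the radius makes the bound on the modulus
proportional to [`|y| ^+ n] on the whole interval. *)
Definition damping (n : nat) : R :=
  \sum_(a < n) \sum_(b < n | (n <= a + b)%N)
     stab_radius n ^+ (a + b - n) / (a`!%:R * b`!%:R).

Definition damped_exp (n : nat) : {poly R} :=
  (1 - damping n *: 'X^n) * exp_trunc R n.

Lemma stab_radius_ge0 n : 0 <= stab_radius n.
Proof. by rewrite !mulr_ge0 ?expR_ge0 ?invr_ge0. Qed.

Lemma damping_ge0 n : 0 <= damping n.
Proof.
apply: sumr_ge0 => a _; apply: sumr_ge0 => b _.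
by rewrite divr_ge0 ?mulr_ge0 ?exprn_ge0 ?stab_radius_ge0.
Qed.

Lemma exp_trunc_le_expR n (y : R) : 0 <= y -> (exp_trunc R n).[y] <= expR y.
Proof.
move=> y0; rewrite horner_exp_trunc -(big_mkord xpredT (fun k => y ^+ k / k`!%:R)).
have := nondecreasing_cvgn_le (nondecreasing_series (fun k _ _ => exp_coeff_ge0 k y0))
  (@is_cvg_series_exp_coeff R y) n.
by apply: le_trans; rewrite /series /exp_coeff/=.
Qed.

(** Since every index satisfies [n <= a + b], one can factor
[expR (- 1) ^+ n] out; what is left is at most the square of a partial sum of
[expR (n / 2)]. *)
Lemma damping_stab_radius n : damping n * stab_radius n ^+ n <= 1.
Proof.
have t0 := expR_ge0 (- 1 : R).
have t1 : expR (- 1 : R) <= 1 by rewrite expR_le1 lerN10.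
have h0 : 0 <= n%:R / 2 :> R by rewrite divr_ge0.
apply: (@le_trans _ _ (expR (- 1) ^+ n * (exp_trunc R n).[n%:R / 2] ^+ 2)).
  rewrite /damping mulr_suml horner_exp_trunc expr2 mulr_suml mulr_sumr.
  apply: ler_sum => a _; rewrite mulr_suml !mulr_sumr.
  rewrite [leRHS](bigID (fun b : 'I_n => (n <= a + b)%N))/=.
  rewrite -[leLHS]addr0 lerD//; last first.
    apply: sumr_ge0 => b _.
    by do ?[exact: ler0n|apply: mulr_ge0|rewrite invr_ge0|apply: exprn_ge0].
  apply: ler_sum => b nab.
  rewrite mulrAC -exprD subnK// exprMn.
  have -> : (n%:R / 2) ^+ (a + b) * expR (-1) ^+ (a + b) / (a`!%:R * b`!%:R) =
     expR (-1) ^+ (a + b)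
       * (((n%:R / 2) ^+ a / a`!%:R) * ((n%:R / 2) ^+ b / b`!%:R)) :> R.
    by rewrite exprD invfM; ring.
  rewrite ler_wpM2r//; last exact: ler_wiXn2l.
have e0 := exp_trunc_le_expR n h0.
have E : expR (- 1) ^+ n * expR (n%:R / 2) ^+ 2 = 1 :> R.
  rewrite -expRM_natl -expRM_natl -expRD.
  have -> : n%:R * -1 + 2 * (n%:R / 2) = 0 :> R by field.
  by rewrite expR0.
rewrite -[leRHS]E ler_wpM2l ?exprn_ge0// lerXn2r ?nnegrE ?expR_ge0//.
rewrite horner_exp_trunc; apply: sumr_ge0 => k _.
by rewrite divr_ge0 ?exprn_ge0.
Qed.

(** With [d = damping n * `|y| ^+ n], the squared modulus is at most
[(1 - d) ^+ 2 * (1 + d) <= 1]. The index is a multiple of [4] for [z ^+ n] to be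
[`|y| ^+ n]: only with this sign does the factor of [exp_trunc] damp. *)
Lemma damped_exp_stable l (y : R) : let n := (4 * l)%N in
  (0 < n)%N -> `|y| <= stab_radius n ->
  `|(map_poly (real_complex R) (damped_exp n)).[real_complex R y * Complex 0 1]| <= 1.
Proof.
move=> n n0 yY.
set z := real_complex R y * _.
have zc : z^*%C = - z.
  rewrite /z; apply/eqP; rewrite eq_complex/=.
  by rewrite !(mulr0, mul0r, mulr1, addr0, add0r, subr0, oppr0, eqxx).
have nz : `|z| = real_complex R `|y|.
  rewrite normc_def /z /=.
  rewrite !(mulr0, mul0r, mulr1, addr0, add0r, subr0, oppr0, eqxx).
  by rewrite expr0n/= add0r sqrtr_sqr.
have z4 : z ^+ n = real_complex R (`|y| ^+ n).
  rewrite /z exprMn /n [X in _ * X]exprM.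
  have -> : (Complex 0 1 : R[i]) ^+ 4 = 1.
    by rewrite (exprM _ 2 2) sqr_i sqrrN expr1n.
  rewrite expr1n mulr1 -rmorphXn/=; congr (real_complex _ _).
  by rewrite !(exprM _ 4 l) !(exprM _ 2 2) real_normK ?num_real.
rewrite /damped_exp rmorphM rmorphB rmorph1/= map_polyZ map_polyXn.
have mapE : map_poly (real_complex R) (exp_trunc R n) = exp_trunc R[i] n.
  rewrite /exp_trunc rmorph_sum/=; apply: eq_bigr => k _.
  by rewrite map_polyZ map_polyXn fmorphV rmorph_nat.
rewrite mapE hornerM !hornerE z4 -rmorphM/=.
set d := damping n * _.
have -> : 1 - real_complex R d = real_complex R (1 - d) by rewrite rmorphB rmorph1.
have d0 : 0 <= d by rewrite mulr_ge0 ?damping_ge0 ?exprn_ge0.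
have d1 : d <= 1.
  apply: le_trans (damping_stab_radius n).
  by rewrite ler_wpM2l ?damping_ge0// lerXn2r ?nnegrE ?stab_radius_ge0.
(* for imaginary z, the conjugate of T z is T (- z) *)
have Tle : `|(exp_trunc R[i] n).[z]| ^+ 2 <= real_complex R (1 + d).
  have -> : `|(exp_trunc R[i] n).[z]| ^+ 2 =
      `|(exp_trunc R[i] n).[z] * (exp_trunc R[i] n).[- z]|.
    rewrite normrM expr2; congr (_ * _).
    have -> : (exp_trunc R[i] n).[- z] = ((exp_trunc R[i] n).[z])^*%C.
      rewrite -zc !horner_exp_trunc rmorph_sum/=; apply: eq_bigr => k _.
      by rewrite rmorphM rmorphXn/= conjc_inv conjc_nat.
    by rewrite !normc_def; case: (_.[z]) => u v/=; rewrite sqrrN.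
  rewrite exp_trunc_mulN// rmorphD rmorph1.
  apply: le_trans (ler_normD _ _) _; rewrite normr1 lerD2l.
  apply: le_trans (ler_norm_sum _ _ _) _.
  rewrite /d /damping mulr_suml rmorph_sum/=; apply: ler_sum => a _.
  apply: le_trans (ler_norm_sum _ _ _) _.
  rewrite mulr_suml rmorph_sum/=; apply: ler_sum => b nab.
  rewrite !normrM !normrX normrN !normfV !normr_nat nz mulrACA -exprD.
  rewrite -!(rmorph_nat (real_complex R)) -rmorphXn -!fmorphV.
  rewrite -!(rmorphM (real_complex R))/= lecR.
  rewrite -[in leLHS](subnK nab) exprD invfM mulrAC.
  rewrite ler_wpM2r ?exprn_ge0// ler_wpM2r//.
  by rewrite lerXn2r ?nnegrE ?stab_radius_ge0.
rewrite -(@ler_pXn2r _ 2) ?nnegrE ?normr_ge0 ?ler01// expr1n normrM exprMn.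
have -> : `|real_complex R (1 - d)| = real_complex R (1 - d).
  by rewrite ger0_norm// ler0c subr_ge0.
rewrite -rmorphXn/=.
apply: le_trans (ler_wpM2l _ Tle) _; first by rewrite ler0c exprn_ge0// subr_ge0.
rewrite -rmorphM -(rmorph1 (real_complex R)) lecR/=.
nra.
Qed.

(** The tail of the series at [z] is [`|z| ^+ n] times a series dominated by that
of [expR 1]. *)
Lemma expR_sub_trunc n (z : R) : `|z| <= 1 ->
  `|expR z - (exp_trunc R n).[z]| <= expR 1 * `|z| ^+ n.
Proof.
move=> z1.
have cv : (`|series (exp_coeff z) m - (exp_trunc R n).[z]| @[m --> \oo] -->
   `|expR z - (exp_trunc R n).[z]|)%classic.
  apply: cvg_norm; apply: cvgB; last exact: cvg_cst.
  exact: is_cvg_series_exp_coeff.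
apply: (cvgr_to_le cv); near=> m.
have nm : (n <= m)%N by near: m; exact: nbhs_infty_ge.
rewrite horner_exp_trunc -(big_mkord xpredT (fun k => z ^+ k / k`!%:R)).
rewrite /series/= (big_cat_nat _ nm)//= addrAC subrr add0r.
apply: le_trans (ler_norm_sum _ _ _) _.
apply: (@le_trans _ _ (`|z| ^+ n * (exp_trunc R m).[1])).
  rewrite horner_exp_trunc -(big_mkord xpredT (fun k => 1 ^+ k / k`!%:R)).
  rewrite [in leRHS](big_cat_nat _ nm)//= mulrDr -[leLHS]add0r; apply: lerD.
    apply: mulr_ge0; first exact: exprn_ge0.
    by apply: sumr_ge0 => i _; rewrite expr1n mul1r invr_ge0.
  rewrite mulr_sumr 2!big_nat; apply: ler_sum => k /andP[nk _].
  rewrite /exp_coeff/= normrM normrX normfV normr_nat expr1n mul1r.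
  by rewrite ler_wpM2r ?invr_ge0// ler_wiXn2l.
by rewrite mulrC ler_wpM2r// exp_trunc_le_expR.
Unshelve. all: by end_near. Qed.

Lemma damped_exp_order n : (0 < n)%N -> has_order (Scheme (damped_exp n) 0) n.-1.
Proof.
move=> n0; rewrite /has_order prednK//=.
apply/eqO_exP; exists (expR 1 + damping n * expR 1).
  by rewrite ltr_wpDr ?expR_gt0// mulr_ge0 ?damping_ge0 ?expR_ge0.
near=> z.
have z1 : `|z| <= 1.
  by near: z; apply/nbhs_normP; exists 1 => //= z/=; rewrite sub0r normrN => /ltW.
rewrite horner0 mul0r subr0 /damped_exp hornerM !hornerE.
set D := damping n; set T := _.[z].
have -> : expR z - (1 - D * z ^+ n) * T = (expR z - T) + D * T * z ^+ n by ring.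
apply: le_trans (ler_normD _ _) _.
rewrite mulrDl normrX; apply: lerD; first exact: expR_sub_trunc.
rewrite normrM normrX ler_wpM2r ?exprn_ge0// normrM (ger0_norm (damping_ge0 _)).
rewrite ler_wpM2l ?damping_ge0//.
apply: (@le_trans _ _ (exp_trunc R n).[1]); last exact: exp_trunc_le_expR.
rewrite /T !horner_exp_trunc.
apply: le_trans (ler_norm_sum _ _ _) _; apply: ler_sum => k _.
rewrite normrM normfV normr_nat ler_wpM2r ?invr_ge0//.
by rewrite expr1n normrX exprn_ile1.
Unshelve. all: by end_near. Qed.

Lemma stages_damped_exp n : (0 < n)%N ->
  (stages (Scheme (damped_exp n) 0) <= n + n)%N.
Proof.
move=> n0; rewrite /stages/= size_poly0 maxn0 /damped_exp.
have h : (size (1 - damping n *: 'X^n)%R <= n.+1)%N.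
  apply: leq_trans (size_polyD _ _) _; rewrite size_polyN geq_max size_poly1 /=.
  by apply: leq_trans (size_scale_leq _ _) _; rewrite size_polyXn.
apply: leq_trans (leq_pred _) _; apply: leq_trans (size_polyMleq _ _) _.
by rewrite -subn1 leq_subLR addnA; exact: leq_add h (size_exp_trunc R n).
Qed.
End DampedExponential.

(** * Polynomials in L2(0, 1) *)

Section PolyIntegral.
Variable R : realType.
Implicit Types p q r : {poly R}.

Definition antideriv p : {poly R} := \poly_(i < (size p).+1) (p`_i.-1 / i%:R).

Lemma coef_antideriv p i : (antideriv p)`_i = p`_i.-1 / i%:R.
Proof.
rewrite coef_poly; case: ifP => // /negbT; rewrite -leqNgt => h.
by rewrite nth_default ?mul0r// -ltnS prednK// (leq_trans _ h).
Qed.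

Lemma antideriv_is_linear : linear antideriv.
Proof.
move=> k p q; apply/polyP => i.
by rewrite coefD coefZ !coef_antideriv coefD coefZ mulrDl mulrA.
Qed.

HB.instance Definition _ := GRing.isLinear.Build R {poly R} {poly R} _ antideriv
  antideriv_is_linear.

Lemma antiderivK p : (antideriv p)^`() = p.
Proof.
apply/polyP => i; rewrite coef_deriv coef_antideriv -[_ *+ _]mulr_natr mulfVK//.
Qed.

Lemma deriv_antideriv p : antideriv p^`() = p - (p`_0)%:P.
Proof.
apply/polyP => -[|i]; rewrite coefB coefC coef_antideriv/= ?subrr ?invr0 ?mulr0//.
by rewrite subr0 coef_deriv -[_ *+ _]mulr_natr mulfK// pnatr_eq0.
Qed.

Lemma intg_poly a b p : a < b ->
  intg a b (fun x => p.[x]) = (antideriv p).[b] - (antideriv p).[a].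
Proof.
move=> ab; rewrite /intg /Rintegral.
rewrite (@continuous_FTC2 _ _ (horner (antideriv p)))//.
- by apply: continuous_subspaceT => x; exact: continuous_horner.
- split.
  + by move=> x _; exact: derivable_horner.
  + by apply: cvg_at_right_filter; exact: continuous_horner.
  + by apply: cvg_at_left_filter; exact: continuous_horner.
- by move=> x _; rewrite -derivE antiderivK.
Qed.

(** The integral over [[0, 1]], defined algebraically so that linearity and
integration by parts hold without integrability conditions; [intg_poly]
relates it to the Lebesgue integral. *)
Definition int01 p : R := (antideriv p).[1] - (antideriv p).[0].

Lemma int01_is_linear : linear_for *%R int01.
Proof.
move=> k p q; rewrite /int01 linearP/= !hornerE/=; ring.
Qed.

HB.instance Definition _ := GRing.isLinear.Build R {poly R} R *%R int01
  int01_is_linear.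

Lemma int01D p q : int01 (p + q) = int01 p + int01 q.
Proof. exact: linearD. Qed.

Lemma int01Z k p : int01 (k *: p) = k * int01 p.
Proof. exact: linearZ. Qed.

Lemma int01Zl k p q : int01 (k *: p * q) = k * int01 (p * q).
Proof. by rewrite -scalerAl int01Z. Qed.

Lemma int01_deriv p : int01 p^`() = p.[1] - p.[0].
Proof. by rewrite /int01 deriv_antideriv !hornerE/=; ring. Qed.

Lemma poly_eq0_on01 p : (forall x, 0 <= x <= 1 -> p.[x] = 0) -> p = 0.
Proof.
move=> p0; pose N := (size p).+1.
pose rs := [seq i%:R / N%:R | i <- iota 0 N] : seq R.
apply: (@roots_geq_poly_eq0 _ p rs).
- rewrite all_map; apply/allP => i; rewrite mem_iota add0n => /andP[_ iN] /=.
  apply/rootP/p0; rewrite divr_ge0//= ler_pdivrMr ?ltr0n// mul1r ler_nat.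
  exact: ltnW.
- rewrite map_inj_uniq ?iota_uniq// => i j /(mulIf _) h; apply/eqP.
  by rewrite -(eqr_nat R) h// invr_eq0 pnatr_eq0.
- by rewrite size_map size_iota.
Qed.

(** The antiderivative of [p * p] is nondecreasing. If it took the same value at
[0] and [1] it would be constant on [[0, 1]], hence a constant polynomial. *)
Lemma int01_sqr_gt0 p : p != 0 -> 0 < int01 (p * p).
Proof.
move=> p0; set q := antideriv (p * p).
have q_ndecr x y : 0 <= x -> x <= y -> y <= 1 -> q.[x] <= q.[y].
  apply: ger0_derive1_ndecr.
  - by move=> t _; exact: derivable_horner.
  - by move=> t _; rewrite -derivE antiderivK hornerM -expr2 sqr_ge0.
  - by apply: continuous_subspaceT => t; exact: continuous_horner.
have q01 : q.[0] <= q.[1] by apply: q_ndecr.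
rewrite /int01 -/q lt_neqAle subr_ge0 q01 andbT eq_sym subr_eq0.
apply: contra p0 => /eqP q10.
have q_cst : q - (q.[0])%:P = 0.
  apply: poly_eq0_on01 => x /andP[x0 x1].
  rewrite !hornerE; apply/eqP; rewrite subr_eq0 eq_le -{1}q10.
  by rewrite !q_ndecr.
have := congr1 (@deriv R) q_cst.
by rewrite derivB derivC subr0 deriv0 antiderivK => /eqP; rewrite mulf_eq0 orbb.
Qed.

Lemma int01_sqr_ge0 p : 0 <= int01 (p * p).
Proof.
by have [->|/int01_sqr_gt0/ltW//] := eqVneq p 0; rewrite mul0r linear0.
Qed.

Lemma int01_cauchy_schwarz p q :
  int01 (p * q) ^+ 2 <= int01 (p * p) * int01 (q * q).
Proof.
have [->|/int01_sqr_gt0 q0] := eqVneq q 0.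
  by rewrite !mulr0 !linear0 mulr0 expr0n.
set B := int01 (p * q); set C := int01 (q * q) in q0 *.
have E (k l : R) : (k *: p - l *: q) * (k *: p - l *: q) =
    (k * k) *: (p * p) + (- (k * l + k * l)) *: (p * q) + (l * l) *: (q * q).
  by rewrite -!mul_polyC !(polyCM, polyCN, polyCD); ring.
have := int01_sqr_ge0 (C *: p - B *: q); rewrite E.
rewrite !int01D !int01Z -/B -/C.
move: (int01 (p * p)) B C q0 => A B C q0 h.
by rewrite -(ler_pM2l q0) expr2; lra.
Qed.

Definition gram n : 'M[R]_n := \matrix_(i, j) int01 ('X^i * 'X^j).

Lemma mul_gram n (u : 'rV[R]_n) j : (u *m gram n) 0 j = int01 (rVpoly u * 'X^j).
Proof.
rewrite mxE /rVpoly poly_def mulr_suml linear_sum/=; apply: eq_bigr => i _.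
by rewrite mxE -scalerAl linearZ/= valK.
Qed.

(** A row in the kernel is the coefficient row of a polynomial orthogonal to all
monomials, thus to itself. *)
Lemma gram_unit n : gram n \in unitmx.
Proof.
rewrite -row_free_unit -kermx_eq0; apply/rowV0P => u /sub_kermxP uG.
apply/eqP; rewrite -(inj_eq (can_inj (@rVpolyK _ _))) linear0.
apply/negP => /negP/int01_sqr_gt0; rewrite {2}/rVpoly poly_def mulr_sumr linear_sum/=.
rewrite big1 ?ltxx// => i _.
by rewrite -scalerAr linearZ/= -mul_gram uG mxE mulr0.
Qed.

(** The inverse of the Gram matrix represents the [j]-th coefficient as the inner
product with a fixed polynomial; the bound is then the Cauchy-Schwarz
inequality. *)
Lemma coef_bounded n : exists2 M : R, 0 <= M &
  forall p i, (size p <= n)%N -> p`_i ^+ 2 <= M * int01 (p * p).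
Proof.
pose dual (j : 'I_n) : {poly R} := \sum_i invmx (gram n) i j *: 'X^i.
have dualP p (j : 'I_n) : (size p <= n)%N -> p`_j = int01 (p * dual j).
  move=> pn; have <- : (poly_rV p *m gram n *m invmx (gram n)) 0 j = p`_j.
    by rewrite mulmxK ?gram_unit// mxE.
  rewrite mxE /dual mulr_sumr linear_sum/=; apply: eq_bigr => i _.
  by rewrite mul_gram poly_rV_K// -scalerAr linearZ/= mulrC.
exists (\sum_j int01 (dual j * dual j)) => [|p i pn].
  by apply: sumr_ge0 => j _; exact: int01_sqr_ge0.
have [i_n|n_i] := ltnP i n; last first.
  rewrite nth_default ?(leq_trans pn)// expr0n mulr_ge0 ?int01_sqr_ge0//.
  by apply: sumr_ge0 => j _; exact: int01_sqr_ge0.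
rewrite (dualP _ (Ordinal i_n))//.
apply: le_trans (int01_cauchy_schwarz _ _) _.
rewrite mulrC ler_wpM2r ?int01_sqr_ge0// (bigD1 (Ordinal i_n))//= lerDl.
by apply: sumr_ge0 => j _; exact: int01_sqr_ge0.
Qed.

Lemma linear_forZ (f : {poly R} -> R) : linear_for *%R f ->
  forall k p, f (k *: p) = k * f p.
Proof.
move=> fP k p; have f0 : f 0 = 0.
  by have := fP (- 1) 0 0; rewrite scaler0 addr0 mulN1r addNr.
by rewrite -[k *: p]addr0 fP f0 addr0.
Qed.

Lemma linear_form_coef (f : {poly R} -> R) n p : linear_for *%R f ->
  (size p <= n)%N -> f p = \sum_(i < n) p`_i * f 'X^i.
Proof.
move=> fP pn.
pose F : {linear {poly R} -> R | *%R} :=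
  HB.pack f (GRing.isLinear.Build R {poly R} R *%R f fP).
rewrite -[LHS]/(F p) -[p in LHS]coefK poly_def linear_sum/=.
rewrite (big_ord_widen n (fun i => F (p`_i *: 'X^i)) pn) big_mkcond/=.
apply: eq_bigr => i _; rewrite linear_forZ//; case: ltnP => // h.
by rewrite nth_default ?mul0r.
Qed.

(** Equivalence of norms in finite dimension: all bilinear forms on polynomials of
bounded degree are controlled by the L2 norm. *)
Lemma bilinear_bounded n (b : {poly R} -> {poly R} -> R) :
  (forall q, linear_for *%R (b^~ q)) -> (forall p, linear_for *%R (b p)) ->
  exists2 M : R, 0 <= M & forall p q, (size p <= n)%N -> (size q <= n)%N ->
    `|b p q| <= M * (int01 (p * p) + int01 (q * q)).
Proof.
move=> bl br; have [M M0 Mc] := coef_bounded n.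
exists (\sum_(i < n) \sum_(j < n) M * `|b 'X^i 'X^j|) => [|p q pn qn].
  by apply: sumr_ge0 => i _; apply: sumr_ge0 => j _; rewrite mulr_ge0.
rewrite (linear_form_coef (bl q) pn).
apply: le_trans (ler_norm_sum _ _ _) _; rewrite mulr_suml.
apply: ler_sum => i _; rewrite (linear_form_coef (br _) qn) mulr_sumr.
apply: le_trans (ler_norm_sum _ _ _) _; rewrite mulr_suml.
apply: ler_sum => j _; rewrite mulrA normrM mulrAC ler_wpM2r//.
rewrite normrM mulrDr.
have := Mc p i pn; have := Mc q j qn.
rewrite -[p`_i ^+ 2]real_normK ?num_real// -[q`_j ^+ 2]real_normK ?num_real//.
have := sqr_ge0 (`|p`_i| - `|q`_j|).
by have := normr_ge0 p`_i; have := normr_ge0 q`_j; nra.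
Qed.
End PolyIntegral.

Section PiecewiseIntegral.
Variable R : realType.
Notation mu := (@lebesgue_measure R).
Implicit Types (f : R -> R) (p : {poly R}).

(** The right endpoint is left out: this is where piecewise polynomials of the
spaces at hand jump, and it does not matter for integrals. *)
Definition agrees f p (a b : R) := forall x, a <= x < b -> f x = p.[x].

Lemma agrees_integrable f p a b : agrees f p a b ->
  mu.-integrable `[a, b[%classic (EFin \o f).
Proof.
move=> fp; apply: (@eq_integrable _ _ _ mu _ _ (EFin \o horner p)) => //.
  by move=> x; rewrite inE/= in_itv/= => /fp ->.
have h : mu.-integrable `[a, b]%classic (EFin \o horner p); last first.
  by apply: integrableS h => //; apply: subset_itvl; rewrite bnd_simp.
apply: continuous_compact_integrable; first exact: segment_compact.
by apply: continuous_subspaceT => x; exact: continuous_horner.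
Qed.

Lemma intg_agrees f p a b : a < b -> agrees f p a b ->
  intg a b f = (antideriv p).[b] - (antideriv p).[a].
Proof.
move=> ab fp; rewrite -intg_poly// /intg.
have ip : agrees (horner p) p a b by [].
rewrite -!Rintegral_itv_bndo_bndc;
  [|exact: (agrees_integrable ip)|exact: (agrees_integrable fp)].
by apply: eq_Rintegral => x; rewrite inE/= in_itv/= => /fp ->.
Qed.

Lemma integrable_itv_cat f a b c : a <= b -> b <= c ->
  mu.-integrable `[a, b[%classic (EFin \o f) ->
  mu.-integrable `[b, c[%classic (EFin \o f) ->
  mu.-integrable `[a, c[%classic (EFin \o f).
Proof.
move=> ab bc /integrable_mkcond fab /integrable_mkcond fbc.
apply/integrable_mkcond => //.
have := integrableD measurableT (fab (measurable_itv _)) (fbc (measurable_itv _)).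
apply: eq_integrable => // x _ /=; rewrite !patchE !mem_setE !in_itv/=.
have [xb|bx] := ltP x b; first by rewrite (lt_le_trans xb bc) !andbT adde0.
by rewrite (le_trans ab bx) andbF/= add0e.
Qed.

Lemma intg_cat f a b c : a <= b -> b <= c ->
  mu.-integrable `[a, b[%classic (EFin \o f) ->
  mu.-integrable `[b, c[%classic (EFin \o f) ->
  intg a c f = intg a b f + intg b c f.
Proof.
move=> ab bc fab fbc; have fac := integrable_itv_cat ab bc fab fbc.
rewrite /intg -!Rintegral_itv_bndo_bndc//.
rewrite (@itv_bndbnd_setU _ _ _ (BLeft b)) ?bnd_simp// Rintegral_setU//.
  by rewrite -itv_bndbnd_setU ?bnd_simp.
apply/disj_setPS => y [/=]; rewrite 2!in_itv/= => /andP[_ yb] /andP[].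
by rewrite leNgt yb.
Qed.

End PiecewiseIntegral.

(** * Piecewise polynomials on the half cells *)

(** The representative of the argument in the fundamental period is [t], as [t]
already lies in the [j]-th element. *)
Lemma pweval_shift (R : realType) N (y0 h : R) (p : 'I_N -> {poly R})
    (j : 'I_N) (m : int) (t : R) : 0 < h ->
  y0 + j%:R * h <= t < y0 + j.+1%:R * h ->
  pweval y0 h p (t + m%:~R * (N%:R * h)) = (p j).[t].
Proof.
move=> h0 /andP[jt tj]; rewrite /pweval.
have N0 : 0 < N%:R * h :> R by rewrite mulr_gt0// ltr0n (leq_ltn_trans _ (ltn_ord j)).
have -> : Num.floor ((t + m%:~R * (N%:R * h) - y0) / (N%:R * h)) = m.
  apply: floor_def; rewrite ler_pdivlMr// ltr_pdivrMr// intrD mulrDl.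
  have j0 : 0 <= j%:R * h by rewrite mulr_ge0// ltW.
  have jN : j.+1%:R * h <= N%:R * h by rewrite ler_pM2r// ler_nat.
  by apply/andP; split; lra.
rewrite addrK (bigD1 j) ?jt ?tj//= big1 ?addr0// => i /andP[/andP[it ti] ij].
exfalso; have : (i < j)%N || (j < i)%N by rewrite -neq_ltn.
case/orP => lt_ij.
  have : i.+1%:R * h <= j%:R * h by rewrite ler_pM2r// ler_nat.
  lra.
have : j.+1%:R * h <= i%:R * h by rewrite ler_pM2r// ler_nat.
lra.
Qed.

Section HalfCells.
Variables (R : realType) (xL xR : R) (N' : nat).
Local Notation N := N'.+1.
Hypothesis xLR : xL < xR.

Definition half_width : R := cell_width xL xR N / 2.
Notation s := half_width.

(** The nodes are the half nodes of even index, the centers those of odd index. *)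
Definition half_node (k : nat) : R := xL + k%:R * s.
Notation hnode := half_node.

Lemma cell_widthE : cell_width xL xR N = 2 * s.
Proof. by rewrite /half_width; field. Qed.

Lemma half_width_gt0 : 0 < s.
Proof. by rewrite !divr_gt0 ?subr_gt0 ?ltr0n. Qed.

Lemma half_nodeS k : hnode k.+1 = hnode k + s.
Proof. by rewrite /half_node mulrSr mulrDl mul1r addrA. Qed.

Lemma nodeE j : node xL xR N j = hnode j.*2.
Proof. by rewrite /node /half_node cell_widthE -muln2 natrM mulrA. Qed.

Lemma centerE j : Defs.center xL xR N j = hnode j.*2.+1.
Proof.
by rewrite /Defs.center !nodeE doubleS !half_nodeS; field.
Qed.

Lemma half_node_end : hnode N.*2 = xR.
Proof.
rewrite /half_node /half_width /cell_width -muln2 natrM.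
have : N%:R != 0 :> R by rewrite pnatr_eq0.
by move: N%:R => x x0; field.
Qed.

(** On the [k]-th half cell, [f] is [P] in the coordinate [xi] that runs over
[[0, 1[]. *)
Definition on_cell (k : nat) (f : R -> R) (P : {poly R}) :=
  forall xi, 0 <= xi < 1 -> f (hnode k + xi * s) = P.[xi].

Section OnCell.
Variables (k : nat) (f : R -> R) (P : {poly R}).
Hypothesis fP : on_cell k f P.

(* P in the global coordinate *)
Let Q : {poly R} := P \Po (s^-1 *: 'X - (hnode k / s)%:P).

Let QE x : Q.[x] = P.[(x - hnode k) / s].
Proof. by rewrite horner_comp !hornerE mulrBl [x / s]mulrC. Qed.

Let f_agrees : agrees f Q (hnode k) (hnode k.+1).
Proof.
move=> x; rewrite half_nodeS QE => /andP[kx xk]; have s0 := half_width_gt0.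
rewrite -fP; first by rewrite mulfVK ?gt_eqF// addrC subrK.
apply/andP; split; first by rewrite divr_ge0 ?subr_ge0// ltW.
by rewrite ltr_pdivrMr// mul1r ltrBlDl.
Qed.

Lemma on_cell_start : f (hnode k) = P.[0].
Proof. by have := @fP 0; rewrite lexx ltr01 mul0r addr0; apply. Qed.

Lemma on_cell_integrable :
  (@lebesgue_measure R).-integrable `[hnode k, hnode k.+1[%classic (EFin \o f).
Proof. exact: agrees_integrable f_agrees. Qed.

Lemma on_cell_intg : intg (hnode k) (hnode k.+1) f = s * int01 P.
Proof.
have s0 := half_width_gt0.
rewrite (intg_agrees _ f_agrees); last by rewrite half_nodeS ltrDl.
pose F := s *: (antideriv P \Po (s^-1 *: 'X - (hnode k / s)%:P)).
have <- : F^`() = Q.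
  rewrite /F derivZ deriv_comp antiderivK derivB derivZ derivX derivC subr0.
  by rewrite -scalerAr mulr1 scalerA mulfV ?gt_eqF// scale1r.
rewrite deriv_antideriv !hornerE /F !horner_comp !hornerE half_nodeS /int01.
have -> : s^-1 * (hnode k + s) - hnode k / s = 1 by field; rewrite gt_eqF.
have -> : s^-1 * (hnode k) - hnode k / s = 0 by field; rewrite gt_eqF.
ring.
Qed.

Lemma on_cell_left_lim : left_lim f (hnode k.+1) = P.[1].
Proof.
have s0 := half_width_gt0.
have <- : Q.[hnode k.+1] = P.[1].
  by rewrite QE half_nodeS addrAC subrr add0r mulfV ?gt_eqF.
apply: cvg_lim => //.
have : (Q.[x] @[x --> (hnode k.+1)^'-] --> Q.[hnode k.+1])%classic.
  by apply: cvg_at_left_filter; exact: continuous_horner.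
apply: cvg_trans; apply: near_eq_cvg; near=> x.
apply/esym/f_agrees; apply/andP; split; last by near: x; exact: nbhs_left_lt.
near: x; apply: nbhs_left_ge; by rewrite half_nodeS ltrDl.
Unshelve. all: by end_near. Qed.

Lemma on_cell_right_lim : right_lim f (hnode k) = P.[0].
Proof.
have s0 := half_width_gt0.
have <- : Q.[hnode k] = P.[0] by rewrite QE subrr mul0r.
apply: cvg_lim => //.
have : (Q.[x] @[x --> (hnode k)^'+] --> Q.[hnode k])%classic.
  by apply: cvg_at_right_filter; exact: continuous_horner.
apply: cvg_trans; apply: near_eq_cvg; near=> x.
apply/esym/f_agrees; apply/andP; split; first by near: x; exact: nbhs_right_ge.
near: x; apply: nbhs_right_lt; by rewrite half_nodeS ltrDl.
Unshelve. all: by end_near. Qed.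
End OnCell.

End HalfCells.

Section CellPoly.
Variables (R : realType) (xL xR : R) (N' : nat).
Local Notation N := N'.+1.
Hypothesis xLR : xL < xR.
Notation s := (half_width xL xR N').
Notation hnode := (half_node xL xR N').
Notation on_cell := (on_cell xL xR N').

(** Position of the [k]-th half cell in the period that starts at the [b]-th half
node, where the elements of the primal grid ([b = 0]) or of the staggered one
([b = 1]) are numbered from. Adding [N.*2 - b] rather than subtracting [b] keeps
truncated subtraction harmless at [k = 0], which belongs to the last staggered
element. *)
Definition offset (b k : nat) : nat := ((k + (N.*2 - b)) %% N.*2)%N.

(** The affine substitution uses the representative of the half cell in the period
where the polynomials [p j] are given, and not the half cell itself: this is
what makes [cellpoly] periodic in [k]. *)
Definition cellpoly (b : nat) (p : 'I_N -> {poly R}) (k : nat) : {poly R} :=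
  p (inord (offset b k)./2) \Po ((hnode (b + offset b k))%:P + s *: 'X).

Lemma ltn_offset b k : (offset b k < N.*2)%N.
Proof. by rewrite ltn_pmod// double_gt0. Qed.

Lemma odd_offset b k : (b <= N.*2)%N -> odd (offset b k) = odd k (+) odd b.
Proof.
by move=> bN; rewrite /offset odd_mod ?odd_double// oddD oddB// odd_double.
Qed.

Lemma offset_period b k : offset b (k + N.*2) = offset b k.
Proof. by rewrite /offset addnAC modnDr. Qed.

Lemma cellpoly_period b p k : cellpoly b p (k + N.*2) = cellpoly b p k.
Proof. by rewrite /cellpoly offset_period. Qed.

Lemma cellpoly_on_cell b p k : (b <= N.*2)%N ->
  on_cell k (pweval (hnode b) (cell_width xL xR N) p) (cellpoly b p k).
Proof.
move=> bN xi /andP[xi0 xi1]; have s0 : 0 < s := half_width_gt0 N' xLR.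
set r := offset b k; set q := ((k + (N.*2 - b)) %/ N.*2)%N.
have kE : (k + (N.*2 - b) = q * N.*2 + r)%N := divn_eq _ _.
have kR : k%:R = (q%:Z - 1)%:~R * N.*2%:R + (b + r)%:R :> R.
  rewrite intrD rmorphN/= rmorph1 mulrBl mul1r -pmulrn -natrM natrD.
  move/(congr1 (fun m => m%:R : R)): kE; rewrite !natrD natrB//; lra.
have -> : hnode k + xi * s =
    (hnode (b + r) + xi * s) + (q%:Z - 1)%:~R * (N%:R * cell_width xL xR N).
  by rewrite /half_node kR cell_widthE -muln2 natrM; ring.
set j : 'I_N := inord r./2.
have jE : r%:R = j%:R * 2 + (odd r)%:R :> R.
  rewrite -natrM -natrD inordK ?muln2 1?addnC ?odd_double_half//.
  by rewrite ltn_half_double ltn_offset.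
rewrite (@pweval_shift _ _ _ _ _ j).
- by rewrite /cellpoly horner_comp hornerD hornerC hornerZ hornerX (mulrC s).
- by rewrite cell_widthE mulr_gt0.
rewrite cell_widthE /half_node !natrD jE mulrSr.
have o1 : (odd r)%:R <= 1 :> R by case: odd.
have := mulr_ge0 xi0 (ltW s0); have : xi * s < s by rewrite gtr_pMl.
have : 0 <= (odd r)%:R * s by rewrite mulr_ge0// ltW.
have : (odd r)%:R * s <= s by rewrite ger_pMl.
move=> h1 h2 h3 h4; apply/andP; split; lra.
Qed.

Lemma cellpoly_deriv b p k :
  cellpoly b (fun j => (p j)^`()) k = s^-1 *: (cellpoly b p k)^`().
Proof.
have s0 : 0 < s := half_width_gt0 N' xLR.
rewrite /cellpoly deriv_comp derivD derivC derivZ derivX add0r -scalerAr mulr1.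
by rewrite scalerA mulVf ?gt_eqF// scale1r.
Qed.

(** Two half cells of the same element carry the same polynomial; [k] is the first
of the two when its parity is that of [b]. *)
Lemma cellpoly_continuous b p k : (b <= N.*2)%N -> odd k = odd b ->
  (cellpoly b p k).[1] = (cellpoly b p k.+1).[0].
Proof.
move=> bN kb; have even_off := odd_offset k bN; rewrite kb addbb in even_off.
have off_lt : ((offset b k).+1 < N.*2)%N.
  rewrite ltn_neqAle ltn_offset andbT; apply/negP => /eqP/(congr1 odd).
  by rewrite /= even_off odd_double.
have offS : offset b k.+1 = (offset b k).+1.
  by rewrite {1}/offset addSn -addn1 -modnDml -/(offset b k) addn1 modn_small.
rewrite /cellpoly offS -[(offset b k).+1./2]/(uphalf _) uphalf_half even_off add0n.
rewrite !horner_comp addnS half_nodeS !hornerD !hornerC !hornerZ !hornerX.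
by rewrite mulr1 mulr0 addr0.
Qed.

Lemma size_cell_map (c : R) : size (c%:P + s *: 'X) = 2.
Proof.
have s0 : 0 < s := half_width_gt0 N' xLR.
rewrite addrC size_polyDl size_scale ?gt_eqF// size_polyX//.
by rewrite ltnS size_polyC leq_b1.
Qed.

Lemma size_cellpoly b (p : 'I_N -> {poly R}) k n : (forall j, size (p j) <= n)%N ->
  (size (cellpoly b p k) <= n)%N.
Proof. by move=> pn; rewrite size_comp_poly2 ?size_cell_map. Qed.

Lemma cellpolyP b (p q : 'I_N -> {poly R}) c k :
  cellpoly b (fun j => c *: p j + q j) k = c *: cellpoly b p k + cellpoly b q k.
Proof. by rewrite /cellpoly comp_polyD comp_polyZ. Qed.

(** Each element contains a half cell, so the polynomials on the half cells
determine the piecewise polynomial. *)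
Lemma cellpoly_eq0 b (p : 'I_N -> {poly R}) (j : 'I_N) : (b <= N.*2)%N ->
  cellpoly b p (b + j.*2) = 0 -> p j = 0.
Proof.
move=> bN; rewrite /cellpoly.
have -> : offset b (b + j.*2) = j.*2.
  rewrite /offset addnAC subnKC// modnDl modn_small// ltn_double.
  exact: ltn_ord.
rewrite doubleK inord_val => /eqP; rewrite comp_poly2_eq0 ?size_cell_map//.
by move/eqP.
Qed.

End CellPoly.

(** * The central operator on the half cells *)

Lemma big_ord_double (V : nmodType) (g : nat -> V) n :
  \sum_(k < n.*2) g k = \sum_(j < n) (g j.*2 + g j.*2.+1).
Proof.
by elim: n => [|n IH]; rewrite ?big_ord0// doubleS !big_ord_recr/= IH addrA.
Qed.

Lemma sum_shift_last (V : zmodType) (A B C D : nat -> V) n : D n = D 0%N ->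
  \sum_(j < n) (A j + B j) + \sum_(j < n) (C j + D j.+1) =
  \sum_(j < n) (A j + D j + (B j + C j)).
Proof.
move=> Dn; rewrite !big_split/=.
have -> : \sum_(j < n) D j.+1 = \sum_(j < n) D j.
  apply: (addrI (D 0%N)).
  by rewrite -(big_ord_recl n (fun j => D j)) big_ord_recr/= Dn addrC.
by rewrite -!addrA; congr (_ + _); rewrite addrA addrC.
Qed.

Section Fluxes.
Variable R : realType.
Implicit Types p q : {poly R}.

(** Contributions to the central form of the two halves of an element of the test
function [p]. The flux is taken at the end of the half cell where [p] jumps:
the left end for the first half, the right one for the second. *)
Definition flux0 p q : R := int01 (p^`() * q) + p.[0] * q.[0].
Definition flux1 p q : R := int01 (p^`() * q) - p.[1] * q.[1].

(** In each half cell the first half of an element of one grid is the second half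
of an element of the other, so [flux0] and [flux1] always come in such pairs,
and together they integrate the derivative of [p * q]. *)
Lemma flux_skew p q : flux0 p q + flux1 q p = 0.
Proof.
have := int01_deriv (p * q); rewrite derivM int01D !hornerM.
by rewrite /flux0 /flux1 [q^`() * p]mulrC => h; rewrite addrACA h; ring.
Qed.

Lemma flux0_linearl q : linear_for *%R (flux0^~ q).
Proof.
move=> k p1 p2; rewrite /flux0 derivD derivZ mulrDl -scalerAl int01D int01Z.
by rewrite hornerD hornerZ; ring.
Qed.

Lemma flux0_linearr p : linear_for *%R (flux0 p).
Proof.
move=> k p1 p2; rewrite /flux0 mulrDr -scalerAr int01D int01Z.
by rewrite hornerD hornerZ; ring.
Qed.

Lemma flux1_linearl q : linear_for *%R (flux1^~ q).
Proof.
move=> k p1 p2; rewrite /flux1 derivD derivZ mulrDl -scalerAl int01D int01Z.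
by rewrite hornerD hornerZ; ring.
Qed.

Lemma flux1_linearr p : linear_for *%R (flux1 p).
Proof.
move=> k p1 p2; rewrite /flux1 mulrDr -scalerAr int01D int01Z.
by rewrite hornerD hornerZ; ring.
Qed.
End Fluxes.

Section CellSums.
Variables (R : realType) (xL xR : R) (N' : nat).
Local Notation N := N'.+1.
Hypothesis xLR : xL < xR.
Notation s := (half_width xL xR N').
Notation hnode := (half_node xL xR N').
Notation on_cell := (on_cell xL xR N').

Lemma intg_cells (f : R -> R) (P : nat -> {poly R}) k n :
  (forall i, on_cell i f (P i)) ->
  intg (hnode k) (hnode (k + n)) f = s * \sum_(i < n) int01 (P (k + i)%N).
Proof.
move=> fP; have s0 : 0 < s := half_width_gt0 N' xLR.
suff [] : intg (hnode k) (hnode (k + n)) f = s * \sum_(i < n) int01 (P (k + i)%N)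
   /\ (@lebesgue_measure R).-integrable
        `[hnode k, hnode (k + n)[%classic (EFin \o f) by [].
elim: n => [|n [IH1 IH2]].
  rewrite addn0 big_ord0 mulr0 /intg set_itv1 Rintegral_set1; split=> //.
  rewrite set_itvco0; exact: integrable_set0.
have le1 : hnode k <= hnode (k + n).
  by rewrite /half_node lerD2l ler_pM2r// ler_nat leq_addr.
have le2 : hnode (k + n) <= hnode (k + n).+1 by rewrite half_nodeS lerDl ltW.
have i2 := on_cell_integrable xLR (fP (k + n)%N).
rewrite addnS; split; last exact: integrable_itv_cat le1 le2 IH2 i2.
rewrite (intg_cat le1 le2 IH2 i2) IH1 (on_cell_intg xLR (fP _)).
by rewrite big_ord_recr/= [RHS]mulrDr.
Qed.

Lemma on_cellM k f g P Q : on_cell k f P -> on_cell k g Q ->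
  on_cell k (fun x => f x * g x) (P * Q).
Proof. by move=> fP gQ xi xi01; rewrite hornerM fP ?gQ. Qed.

Lemma on_cellD k f g P Q : on_cell k f P -> on_cell k g Q ->
  on_cell k (fun x => f x + g x) (P + Q).
Proof. by move=> fP gQ xi xi01; rewrite hornerD fP ?gQ. Qed.

(** The integral is invariant under the change of variable, because the derivative
brings the factor [s^-1] that compensates the length of the half cell. The value
of [g] at the right end of the element is read on the next half cell; as [g] is
continuous there, it can be read on the last half cell of the element instead,
which makes every term local to one half cell. *)
Lemma element_flux (f f' g : R -> R) (P Q : nat -> {poly R}) k :
  (forall i, on_cell i f (P i)) -> (forall i, on_cell i f' (s^-1 *: (P i)^`())) ->
  (forall i, on_cell i g (Q i)) -> (Q k.+1).[1] = (Q k.+2).[0] ->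
  intg (hnode k) (hnode k.+2) (fun x => f' x * g x)
    - left_lim f (hnode k.+2) * g (hnode k.+2)
    + right_lim f (hnode k) * g (hnode k)
  = flux0 (P k) (Q k) + flux1 (P k.+1) (Q k.+1).
Proof.
move=> fP f'P gQ Qk; have s0 : 0 < s := half_width_gt0 N' xLR.
have := @intg_cells _ _ k 2 (fun i => on_cellM (f'P i) (gQ i)).
rewrite !addnS !addn0 => ->.
rewrite (on_cell_left_lim xLR (fP _)) (on_cell_right_lim xLR (fP _)).
rewrite !(on_cell_start (gQ _)) -Qk /flux0 /flux1.
rewrite !big_ord_recl big_ord0 /= addn0 addn1 addr0 !int01Zl.
move: (int01 _) (int01 _) => A B.
by field; rewrite gt_eqF.
Qed.

Variables (qu qv : nat).
Implicit Types (w phi : pw R N qu) (v psi : pw R N qv.+1).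

Definition ucell w := cellpoly xL xR 0 (fun j => val (w j)).
Definition vcell v := cellpoly xL xR 1 (fun j => val (v j)).

Lemma ueval_on_cell w k : on_cell k (ueval xL xR w) (ucell w k).
Proof. by rewrite /ueval nodeE; exact: cellpoly_on_cell. Qed.

Lemma veval_on_cell v k : on_cell k (veval xL xR v) (vcell v k).
Proof. by rewrite /veval centerE; exact: cellpoly_on_cell. Qed.

Lemma ueval_x_on_cell w k : on_cell k (ueval_x xL xR w) (s^-1 *: (ucell w k)^`()).
Proof.
by rewrite /ueval_x nodeE -cellpoly_deriv//; exact: cellpoly_on_cell.
Qed.

Lemma veval_x_on_cell v k : on_cell k (veval_x xL xR v) (s^-1 *: (vcell v k)^`()).
Proof.
by rewrite /veval_x centerE -cellpoly_deriv//; exact: cellpoly_on_cell.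
Qed.

Lemma L2_inner_cells (W Z : state R N qu qv) :
  L2_inner xL xR W Z = s * \sum_(k < N.*2)
    int01 (ucell W.1 k * ucell Z.1 k + vcell W.2 k * vcell Z.2 k).
Proof.
have h0 : hnode 0 = xL by rewrite /half_node mul0r addr0.
have := @intg_cells _ _ 0 N.*2 (fun k => on_cellD
  (on_cellM (ueval_on_cell W.1 k) (ueval_on_cell Z.1 k))
  (on_cellM (veval_on_cell W.2 k) (veval_on_cell Z.2 k))).
by rewrite add0n half_node_end h0.
Qed.

(** The last staggered half cell lies beyond [xR] and is moved back to the first
one by periodicity; this groups the terms by half cell. *)
Lemma central_form_cells c w v phi psi : central_form xL xR c w v phi psi =
  - c ^+ 2 * \sum_(j < N)
    (flux0 (ucell phi j.*2) (vcell v j.*2)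
     + flux1 (vcell psi j.*2) (ucell w j.*2)
     + (flux1 (ucell phi j.*2.+1) (vcell v j.*2.+1)
        + flux0 (vcell psi j.*2.+1) (ucell w j.*2.+1))).
Proof.
rewrite /central_form -(mulNr (c ^+ 2)) -mulrDr; congr (_ * _).
have E1 (j : 'I_N) : intg (node xL xR N j) (node xL xR N j.+1)
      (fun x => ueval_x xL xR phi x * veval xL xR v x)
    - left_lim (ueval xL xR phi) (node xL xR N j.+1)
      * veval xL xR v (node xL xR N j.+1)
    + right_lim (ueval xL xR phi) (node xL xR N j)
      * veval xL xR v (node xL xR N j) =
  flux0 (ucell phi j.*2) (vcell v j.*2) + flux1 (ucell phi j.*2.+1) (vcell v j.*2.+1).
  rewrite !nodeE doubleS.
  apply: (element_flux (ueval_on_cell phi) (ueval_x_on_cell phi) (veval_on_cell v)).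
  by apply: cellpoly_continuous => //=; rewrite odd_double.
have E2 (j : 'I_N) : intg (Defs.center xL xR N j) (Defs.center xL xR N j.+1)
      (fun x => veval_x xL xR psi x * ueval xL xR w x)
    - left_lim (veval xL xR psi) (Defs.center xL xR N j.+1)
      * ueval xL xR w (Defs.center xL xR N j.+1)
    + right_lim (veval xL xR psi) (Defs.center xL xR N j)
      * ueval xL xR w (Defs.center xL xR N j) =
  flux0 (vcell psi j.*2.+1) (ucell w j.*2.+1)
    + flux1 (vcell psi j.+1.*2) (ucell w j.+1.*2).
  rewrite !centerE doubleS.
  apply: (element_flux (veval_on_cell psi) (veval_x_on_cell psi) (ueval_on_cell w)).
  by apply: cellpoly_continuous => //=; rewrite odd_double.
rewrite (eq_bigr _ (fun j _ => E1 j)) (eq_bigr _ (fun j _ => E2 j)).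
apply: (@sum_shift_last _ (fun j => flux0 (ucell phi j.*2) (vcell v j.*2))
  (fun j => flux1 (ucell phi j.*2.+1) (vcell v j.*2.+1))
  (fun j => flux0 (vcell psi j.*2.+1) (ucell w j.*2.+1))
  (fun j => flux1 (vcell psi j.*2) (ucell w j.*2))).
by rewrite /vcell /ucell -[N.*2]add0n !cellpoly_period.
Qed.

End CellSums.

Section CentralOperator.
Variables (R : realType) (xL xR : R) (N' : nat) (qu qv : nat) (c : R).
Local Notation N := N'.+1.
Hypotheses (xLR : xL < xR) (c0 : 0 < c).
Notation s := (half_width xL xR N').
Notation E := (state R N qu qv).
Notation ip := (@L2_inner R xL xR N qu qv).
Notation U := (@ucell R xL xR N' qu).
Notation V := (@vcell R xL xR N' qv).

Lemma ucellP k (w z : pw R N qu) i : U (k *: w + z) i = k *: U w i + U z i.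
Proof.
rewrite -cellpolyP; congr (cellpoly _ _ _ _ _); apply/funext => j.
by rewrite !ffunE.
Qed.

Lemma vcellP k (v z : pw R N qv.+1) i : V (k *: v + z) i = k *: V v i + V z i.
Proof.
rewrite -cellpolyP; congr (cellpoly _ _ _ _ _); apply/funext => j.
by rewrite !ffunE.
Qed.

Lemma ucellZ k (w : pw R N qu) i : U (k *: w) i = k *: U w i.
Proof.
rewrite /ucell /cellpoly -comp_polyZ; congr (_ \Po _); by rewrite !ffunE.
Qed.

Lemma L2_innerP k (x y z : E) : ip (k *: x + y) z = k * ip x z + ip y z.
Proof.
rewrite !L2_inner_cells// (mulrCA k) -[RHS]mulrDr; congr (_ * _).
rewrite mulr_sumr -big_split/=; apply: eq_bigr => i _.
by rewrite ucellP vcellP !mulrDl -!scalerAl addrACA -scalerDr int01D int01Z.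
Qed.

Lemma L2_innerC (x y : E) : ip x y = ip y x.
Proof.
rewrite !L2_inner_cells//; congr (_ * _); apply: eq_bigr => i _.
by rewrite [U _ _ * _]mulrC [V _ _ * _]mulrC.
Qed.

Lemma L2_inner_gt0 (x : E) : x != 0 -> 0 < ip x x.
Proof.
move=> x0; have s0 : 0 < s := half_width_gt0 N' xLR.
rewrite L2_inner_cells// pmulr_rgt0// lt_neqAle; apply/andP; split; last first.
  by apply: sumr_ge0 => i _; rewrite int01D addr_ge0 ?int01_sqr_ge0.
apply: contra x0; rewrite eq_sym psumr_eq0 => [/allP h|i _]; last first.
  by rewrite int01D addr_ge0 ?int01_sqr_ge0.
have cells0 k : (k < N.*2)%N -> U x.1 k = 0 /\ V x.2 k = 0.
  move=> kN; have := h (Ordinal kN) (mem_index_enum _); rewrite /= int01D.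
  rewrite paddr_eq0 ?int01_sqr_ge0// => /andP[u0 v0]; split; apply/eqP.
    by apply: contraTT u0 => /int01_sqr_gt0; rewrite lt_neqAle eq_sym => /andP[].
  by apply: contraTT v0 => /int01_sqr_gt0; rewrite lt_neqAle eq_sym => /andP[].
case: x h cells0 => w v /= _ cells0; rewrite -[0]/(0, 0) xpair_eqE.
apply/andP; split; apply/eqP/ffunP => j; rewrite ffunE; apply: val_inj => /=.
  have [] := cells0 j.*2; first by rewrite ltn_double.
  by move=> + _; exact: (@cellpoly_eq0 _ _ _ _ xLR 0 (fun j => val (w j))).
have [] := cells0 j.*2.+1; first by rewrite ltn_Sdouble ltn_ord.
by move=> _; exact: (@cellpoly_eq0 _ _ _ _ xLR 1 (fun j => val (v j))).
Qed.

Variable L : 'End(E).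
Hypothesis L_central : is_central_operator xL xR c L.

(** Multiplying the first component by [c], as in the definition of the operator,
distributes the factor [c ^+ 2] evenly: only [c] remains. *)
Lemma central_operator_cells (x y : E) : ip (L x) y =
  - c * \sum_(j < N)
    (flux0 (U y.1 j.*2) (V x.2 j.*2) + flux1 (V y.2 j.*2) (U x.1 j.*2)
     + (flux1 (U y.1 j.*2.+1) (V x.2 j.*2.+1)
        + flux0 (V y.2 j.*2.+1) (U x.1 j.*2.+1))).
Proof.
case: x y => w v [phi psi] /=.
have cV : c != 0 by rewrite gt_eqF.
have := L_central (c^-1 *: w) (c^-1 *: phi) v psi.
rewrite !scalerA mulfV// !scale1r => ->.
rewrite central_form_cells// !mulr_sumr; apply: eq_bigr => j _.
rewrite !ucellZ.
rewrite !(linear_forZ (@flux0_linearl _ _)) !(linear_forZ (@flux0_linearr _ _)).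
rewrite !(linear_forZ (@flux1_linearl _ _)) !(linear_forZ (@flux1_linearr _ _)).
by field.
Qed.

Lemma central_operator_skew (x : E) : ip (L x) x = 0.
Proof.
rewrite central_operator_cells big1 ?mulr0// => j _.
by rewrite flux_skew [flux1 _ _ + _]addrC flux_skew addr0.
Qed.

Lemma central_operator_bounded (M : R) :
  (forall p q : {poly R}, (size p <= maxn qu qv.+1)%N -> (size q <= maxn qu qv.+1)%N ->
    `|flux0 p q| <= M * (int01 (p * p) + int01 (q * q)) /\
    `|flux1 p q| <= M * (int01 (p * p) + int01 (q * q))) ->
  forall x y : E, `|ip (L x) y| <= c * M / s * (ip x x + ip y y).
Proof.
move=> fluxM x y; have s0 : 0 < s := half_width_gt0 N' xLR.
have sizeU w i : (size (U w i) <= maxn qu qv.+1)%N.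
  apply: leq_trans (leq_maxl _ _); apply: size_cellpoly => // j.
  exact: size_npoly.
have sizeV v i : (size (V v i) <= maxn qu qv.+1)%N.
  apply: leq_trans (leq_maxr _ _); apply: size_cellpoly => // j.
  exact: size_npoly.
rewrite central_operator_cells !L2_inner_cells//.
rewrite (big_ord_double (fun k => int01 (U x.1 k * U x.1 k + V x.2 k * V x.2 k))).
rewrite (big_ord_double (fun k => int01 (U y.1 k * U y.1 k + V y.2 k * V y.2 k))).
have factor A B : c * M / s * (s * A + s * B) = c * (M * (A + B)).
  by field; rewrite gt_eqF.
rewrite factor normrM normrN (gtr0_norm c0) ler_pM2l// -big_split mulr_sumr.
apply: le_trans (ler_norm_sum _ _ _) _; apply: ler_sum => j _.
rewrite /= !int01D.
have [h1 _] := fluxM _ _ (sizeU y.1 j.*2) (sizeV x.2 j.*2).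
have [_ h2] := fluxM _ _ (sizeV y.2 j.*2) (sizeU x.1 j.*2).
have [_ h3] := fluxM _ _ (sizeU y.1 j.*2.+1) (sizeV x.2 j.*2.+1).
have [h4 _] := fluxM _ _ (sizeV y.2 j.*2.+1) (sizeU x.1 j.*2.+1).
apply: le_trans (ler_normD _ _) _.
apply: le_trans (lerD (ler_normD _ _) (ler_normD _ _)) _.
apply: le_trans (lerD (lerD h1 h2) (lerD h3 h4)) _; rewrite -!mulrDr.
by rewrite le_eqVlt; apply/orP; left; apply/eqP; congr (_ * _); ring.
Qed.
End CentralOperator.

(** * Spectrum and stability *)

Section SkewEigenvalue.
Import passmx.
Variables (R : realType) (E : vectType R) (L : 'End(E)).

(** Real and imaginary parts of an eigenvector. *)
Lemma complex_eigenvectorP (lambda : R[i]) : complex_eigenvalue L lambda ->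
  exists a b : E, [/\ (a != 0) || (b != 0),
    L a = complex.Re lambda *: a - complex.Im lambda *: b &
    L b = complex.Im lambda *: a + complex.Re lambda *: b].
Proof.
case/eigenvalueP => x xM x0.
set e := vbasis {:E} in xM; have eB : basis_of {:E} e by exact: vbasisP.
set M := mxof e e L in xM.
pose re := map_mx (@complex.Re R) x; pose im := map_mx (@complex.Im R) x.
have E1 i : \sum_j x 0 j * (M j i)%:C%C = lambda * x 0 i.
  have /matrixP/(_ 0 i) := xM; rewrite !mxE => <-.
  by apply: eq_bigr => j _; rewrite !mxE.
have Er : re *m M = complex.Re lambda *: re - complex.Im lambda *: im.
  apply/rowP => i; rewrite !mxE; have /(congr1 (@complex.Re R)) := E1 i.
  rewrite raddf_sum/=; case: lambda {xM E1} => l1 l2 /=.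
  case: (x 0 i) => x1 x2 /= <-; apply: eq_bigr => j _; rewrite !mxE.
  by case: (x 0 j) => y1 y2 /=; rewrite mulr0 subr0.
have Ei : im *m M = complex.Im lambda *: re + complex.Re lambda *: im.
  apply/rowP => i; rewrite !mxE; have /(congr1 (@complex.Im R)) := E1 i.
  rewrite raddf_sum/=; case: lambda {xM E1 Er} => l1 l2 /=.
  case: (x 0 i) => x1 x2 /=; rewrite addrC => <-; apply: eq_bigr => j _; rewrite !mxE.
  by case: (x 0 j) => y1 y2 /=; rewrite mulr0 add0r.
exists (vecof e re), (vecof e im); split.
- rewrite !vecof_eq0// -negb_and; apply: contra x0 => /andP[/eqP r0 /eqP i0].
  apply/eqP/rowP => i; rewrite mxE.
  have /rowP/(_ i) := r0; have /rowP/(_ i) := i0; rewrite !mxE.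
  by case: (x 0 i) => x1 x2 /= -> ->.
- by rewrite (hom_vecof e eB) -/M Er linearB !linearZ.
- by rewrite (hom_vecof e eB) -/M Ei linearD !linearZ.
Qed.

Variables (ip : E -> E -> R) (K : R).
Hypothesis ipP : forall k x y z, ip (k *: x + y) z = k * ip x z + ip y z.
Hypothesis ipC : forall x y, ip x y = ip y x.
Hypothesis ip_gt0 : forall x, x != 0 -> 0 < ip x x.
Hypothesis L_skew : forall x, ip (L x) x = 0.
Hypothesis L_bounded : forall x y, `|ip (L x) y| <= K * (ip x x + ip y y).

(** For an eigenvector [a + i b] of [al + i be], the sum of [<L a, a>] and
[<L b, b>] is [al (|a|^2 + |b|^2)], whence [al = 0]; then
[<L b, a> - <L a, b>] is [be (|a|^2 + |b|^2)], which bounds [be]. *)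
Lemma skew_eigenvalue (lambda : R[i]) : complex_eigenvalue L lambda ->
  exists2 b : R, lambda = real_complex R b * Complex 0 1 & `|b| <= 2 * K.
Proof.
case/complex_eigenvectorP => a [b [ab0]].
case: lambda => al be /= La Lb.
have ip00 z : ip 0 z = 0.
  have /eqP := ipP 1 0 0 z.
  by rewrite scaler0 addr0 mul1r addrC -subr_eq subrr eq_sym => /eqP.
have ip_ge0 z : 0 <= ip z z.
  by have [->|/ip_gt0/ltW//] := eqVneq z 0; rewrite ip00.
have Q0 : 0 < ip a a + ip b b.
  case/orP: ab0 => /ip_gt0 h; first by rewrite ltr_wpDr.
  by rewrite ltr_wpDl.
have ipZ k y z : ip (k *: y) z = k * ip y z.
  by rewrite -[k *: y]addr0 ipP ip00 addr0.
have LaE z : ip (L a) z = al * ip a z - be * ip b z.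
  by rewrite La -scaleNr ipP ipZ mulNr.
have LbE z : ip (L b) z = be * ip a z + al * ip b z.
  by rewrite Lb ipP ipZ.
have al0 : al = 0.
  have h1 := L_skew a; have h2 := L_skew b.
  rewrite LaE (ipC b a) in h1; rewrite LbE in h2.
  have : al * (ip a a + ip b b) = 0 by rewrite mulrDr; lra.
  by move/eqP; rewrite mulf_eq0 (gt_eqF Q0) orbF => /eqP.
exists be.
  rewrite al0; apply/eqP; rewrite eq_complex/=.
  by rewrite !(mulr0, mul0r, mulr1, addr0, add0r, subr0, oppr0, eqxx).
have h1 := L_bounded b a; have h2 := L_bounded a b.
rewrite -(ler_pM2r Q0) -[X in _ * X](ger0_norm (ltW Q0)) -normrM.
have -> : be * (ip a a + ip b b) = ip (L b) a - ip (L a) b.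
  by rewrite LaE LbE al0; ring.
apply: le_trans (ler_normB _ _) _.
lra.
Qed.
End SkewEigenvalue.

Lemma central_spectrum (R : realType) (qu qv : nat) :
  exists2 K : R, 0 <= K & forall (xL xR c : R) (N : nat) (L : 'End(state R N qu qv)),
    xL < xR -> (0 < N)%N -> 0 < c -> is_central_operator xL xR c L ->
    forall lambda : R[i], complex_eigenvalue L lambda ->
    exists2 b : R, lambda = real_complex R b * Complex 0 1 &
      `|b| * cell_width xL xR N <= K * c.
Proof.
have [M0 M0_ge0 flux0M] := bilinear_bounded (maxn qu qv.+1)
  (@flux0_linearl R) (@flux0_linearr R).
have [M1 M1_ge0 flux1M] := bilinear_bounded (maxn qu qv.+1)
  (@flux1_linearl R) (@flux1_linearr R).
(* one factor 2 is that of skew_eigenvalue, the other one comes from s = h / 2 *)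
exists (4 * (M0 + M1)); first by rewrite mulr_ge0// addr_ge0.
move=> xL xR c [//|N'] L xLR _ c0 Lc lambda /skew_eigenvalue lambdaP.
have s0 : 0 < half_width xL xR N' := half_width_gt0 N' xLR.
have fluxM (p q : {poly R}) :
    (size p <= maxn qu qv.+1)%N -> (size q <= maxn qu qv.+1)%N ->
    `|flux0 p q| <= (M0 + M1) * (int01 (p * p) + int01 (q * q)) /\
    `|flux1 p q| <= (M0 + M1) * (int01 (p * p) + int01 (q * q)).
  move=> pn qn; have pq0 : 0 <= int01 (p * p) + int01 (q * q).
    by rewrite addr_ge0 ?int01_sqr_ge0.
  split; [apply: le_trans (flux0M _ _ pn qn) _|apply: le_trans (flux1M _ _ pn qn) _].
    by rewrite ler_wpM2r// lerDl.
  by rewrite ler_wpM2r// lerDr.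
have [b -> b_le] := lambdaP _ _ (L2_innerP xLR) (@L2_innerC _ _ _ _ _ _ xLR)
  (L2_inner_gt0 xLR) (central_operator_skew xLR c0 Lc)
  (central_operator_bounded xLR c0 Lc fluxM).
exists b => //; rewrite cell_widthE.
move: (half_width _ _ _) s0 b_le => s s0 b_le.
have s20 : 0 < 2 * s by rewrite mulr_gt0.
rewrite -ler_pdivlMr//; apply: le_trans b_le _.
rewrite le_eqVlt; apply/orP; left; apply/eqP; field.
by rewrite gt_eqF.
Qed.

Theorem theorem3 (R : realType) :
  exists C1 C2 : R, 0 < C1 /\ 0 < C2 /\
  forall qu qv : nat, (1 <= qu)%N ->
  exists (S : scheme R) (qT : nat),
    (maxn qu qv <= qT)%N /\
    has_order S qT /\
    (stages S)%:R <= C2 * qT%:R /\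
    forall (xL xR c dt : R) (N : nat) (L : 'End(state R N qu qv)),
      xL < xR -> (0 < N)%N -> 0 < c -> 0 < dt ->
      is_central_operator xL xR c L ->
      c * dt <= C1 * cell_width xL xR N ->
      von_neumann_stable S dt L.
Proof.
exists 1, 3; do 2!split => //; move=> qu qv _.
have [K K0 spectrum] := central_spectrum R qu qv.
(* the first term makes the order large enough, the second one the radius *)
pose l := (maxn qu qv + Num.bound (K * expR 1)).+1.
pose n := (4 * l)%N.
have n0 : (0 < n)%N by [].
have K_le : K <= stab_radius R n.
  have -> : K = K * expR 1 * expR (- 1) by rewrite -mulrA -expRD subrr expR0 mulr1.
  rewrite ler_wpM2r ?expR_ge0// ler_pdivlMr//.
  have Ke0 : 0 <= K * expR 1 by rewrite mulr_ge0 ?expR_ge0.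
  have Kb := archi_boundP Ke0.
  have : (Num.bound (K * expR 1))%:R * 2 <= n%:R :> R.
    by rewrite -natrM ler_nat /n /l; lia.
  lra.
exists (Scheme (damped_exp R n) 0), n.-1; split; last split; last split.
- rewrite /n /l; lia.
- exact: damped_exp_order.
- have := stages_damped_exp R n0; rewrite -(ler_nat R) => /le_trans; apply.
  rewrite -natrM ler_nat /n /l; lia.
move=> xL xR c dt N L xLR N0 c0 dt0 Lc cfl lambda.
move=> /(spectrum _ _ _ _ _ xLR N0 c0 Lc)[b -> b_le] zeta z /=.
have h0 : 0 < cell_width xL xR N by rewrite divr_gt0 ?subr_gt0 ?ltr0n.
have y_le : `|dt * b| <= stab_radius R n.
  apply: le_trans K_le; rewrite normrM (gtr0_norm dt0) -(ler_pM2r h0).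
  rewrite -mulrA; apply: le_trans (ler_wpM2l (ltW dt0) b_le) _.
  rewrite mulrCA ler_wpM2l//; lra.
rewrite rmorph0 horner0 addr0 expr2 => /eqP.
rewrite -subr_eq0 -mulrBl mulf_eq0 => /orP[|/eqP->]; last by rewrite normr0.
rewrite subr_eq0 => /eqP ->.
have -> : z = real_complex R (dt * b) * Complex 0 1 by rewrite /z mulrA -rmorphM.
exact: damped_exp_stable.
Qed.
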